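(* Let $n,m$ be coprime positive integers, let $b\in\mathbb{C}$, $c\in\mathbb{C}\setminus\{0\}$, let $h(z)=z^{n+m}+b\,\overline{z}^{\,m}+c$, and let $v>0$ be a real number. Put $$R=\frac{v^n}{2m}(n+2m),\qquad r=\frac{v^n}{2m}\,n,\qquad d=\frac{|c|}{v^m},\qquad \gamma=\arg c .$$ Then $h$ has a root $\zeta\in\mathbb{C}$ with $|\zeta|=v$ if and only if $b$ lies, up to rotation, on the trochoid with parameters $R,r,d$; precisely, if and only if $-b\in\mathcal{T}(R,r,d,\gamma)$.
   Context: For real $R,r,d>0$ and $\gamma\in\mathbb{R}$, the trochoid (centered at the origin) with parameters $R,r,d$ and phase $\gamma$ is the plane curve $$\mathcal{T}(R,r,d,\gamma)=\Big\{(R-r)e^{i\varphi}+d\,e^{i\left(\gamma+\frac{R-r}{2R}\varphi\right)}:\ \varphi\in\mathbb{R}\Big\}\subset\mathbb{C}.$$ A root of $h$ is a point $\zeta\in\mathbb{C}$ with $h(\zeta)=0$; its norm is $|\zeta|$. *)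

(* Defs.v *)
From Stdlib Require Import Reals Lra.
From Coquelicot Require Export Coquelicot.
Open Scope R_scope.

(* [expi t] is e^{it}; Coquelicot has no complex exponential. *)
Definition expi (t : R) : C := (cos t, sin t).

(* Principal argument, in (-PI, PI]; its value at 0 is not meaningful. *)
Definition Carg (z : C) : R :=
  if Rle_dec 0 (Im z) then acos (Re z / Cmod z) else - acos (Re z / Cmod z).

(* A point set in the plane is a predicate on C.  The curve is meant for
   positive [R0], [r], [d]. *)
Definition trochoid (R0 r d gamma : R) (w : C) : Prop :=
  exists phi : R,
    w = (RtoC (R0 - r) * expi phi
         + RtoC d * expi (gamma + (R0 - r) / (2 * R0) * phi))%C.

Lemma Re_div_Cmod_bound (z : C) (hz : z <> RtoC 0) : -1 <= Re z / Cmod z <= 1.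
Proof.
pose proof (proj1 (Cmod_gt_0 z) hz) as Hp.
pose proof (re_le_Cmod z) as Hr; apply Rabs_le_between in Hr.
split.
- apply (Rmult_le_reg_r (Cmod z)); [exact Hp|]; field_simplify; lra.
- apply (Rmult_le_reg_r (Cmod z)); [exact Hp|]; field_simplify; lra.
Qed.

Lemma Carg_polar (z : C) (hz : z <> RtoC 0) :
  z = (RtoC (Cmod z) * expi (Carg z))%C.
Proof.
pose proof (proj1 (Cmod_gt_0 z) hz) as Hp.
pose proof (Re_div_Cmod_bound z hz) as Hb.
assert (Hsq : Cmod z * Cmod z = Re z * Re z + Im z * Im z).
{ unfold Cmod, Re, Im; rewrite sqrt_sqrt; nra. }
assert (Hs : Cmod z * sin (acos (Re z / Cmod z)) = Rabs (Im z)).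
{ rewrite sin_acos by exact Hb.
  rewrite <- (sqrt_Rsqr (Cmod z)) at 1 by lra.
  rewrite <- sqrt_mult_alt by apply Rle_0_sqr.
  rewrite <- sqrt_Rsqr_abs; f_equal; unfold Rsqr.
  replace (Im z * Im z) with (Cmod z * Cmod z - Re z * Re z) by lra.
  field; lra. }
assert (Hc : Cmod z * cos (acos (Re z / Cmod z)) = Re z).
{ rewrite cos_acos by exact Hb; field; lra. }
unfold Carg, expi; destruct (Rle_dec 0 (Im z)) as [Hi|Hi].
- rewrite Rabs_pos_eq in Hs by lra.
  apply injective_projections; simpl; fold (Re z) (Im z); lra.
- rewrite Rabs_left in Hs by lra.
  rewrite cos_neg, sin_neg.
  apply injective_projections; simpl; fold (Re z) (Im z); lra.
Qed.

Lemma Carg_bound (z : C) (hz : z <> RtoC 0) : - PI < Carg z <= PI.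
Proof.
pose proof (proj1 (Cmod_gt_0 z) hz) as Hp.
pose proof (acos_bound (Re z / Cmod z)) as Hab; pose proof PI_RGT_0 as Hpi.
unfold Carg; destruct (Rle_dec 0 (Im z)) as [Hi|Hi]; [lra|].
split; [|lra].
destruct (Req_dec (acos (Re z / Cmod z)) PI) as [He|He]; [exfalso|lra].
pose proof (Carg_polar z hz) as Hz; unfold Carg in Hz.
destruct (Rle_dec 0 (Im z)) as [?|_]; [lra|].
rewrite He in Hz; apply (f_equal Im) in Hz.
unfold expi in Hz; rewrite sin_neg, sin_PI in Hz; simpl in Hz; lra.
Qed.

(* Main.v *)
Require Import Defs.
From Stdlib Require Import Reals Lra.
From Coquelicot Require Import Coquelicot.
Open Scope R_scope.

(** On the circle [zeta = v e^{i theta}] one has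
    [h zeta = v^m e^{-i m theta} (b + T theta)], where
    [T theta = v^n e^{i (n + 2 m) theta} + (|c| / v^m) e^{i (arg c + m theta)}],
    so [zeta] is a root iff [- b = T theta].  Since [R - r = v^n] and
    [(R - r) / (2 R) = m / (n + 2 m)], the substitution [phi = (n + 2 m) theta]
    turns [T] into the parametrization of the trochoid. *)

Lemma expi_plus (s t : R) : expi (s + t) = (expi s * expi t)%C.
Proof.
unfold expi; rewrite cos_plus, sin_plus.
apply injective_projections; simpl; ring.
Qed.

Lemma expi_0 : expi 0 = RtoC 1.
Proof. unfold expi; rewrite cos_0, sin_0; reflexivity. Qed.

Lemma Cconj_expi (t : R) : Cconj (expi t) = expi (- t).
Proof. unfold Cconj, expi; rewrite cos_neg, sin_neg; reflexivity. Qed.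

Lemma Cmod_expi (t : R) : Cmod (expi t) = 1.
Proof.
unfold Cmod, expi; rewrite <- sqrt_1 at 1; f_equal; simpl.
pose proof (sin2_cos2 t) as H; unfold Rsqr in H; lra.
Qed.

Lemma expi_neq_0 (t : R) : expi t <> RtoC 0.
Proof. apply Cmod_gt_0; rewrite Cmod_expi; lra. Qed.

Lemma expi_pow (t : R) (k : nat) : (expi t ^ k)%C = expi (INR k * t).
Proof.
induction k as [|k IH].
- rewrite Rmult_0_l, expi_0; reflexivity.
- rewrite S_INR, Rmult_plus_distr_r, Rmult_1_l, expi_plus, <- IH.
  simpl; ring.
Qed.

Lemma polar_pow (v t : R) (k : nat) :
  ((RtoC v * expi t) ^ k)%C = (RtoC (v ^ k) * expi (INR k * t))%C.
Proof. rewrite Cpow_mult_l, expi_pow, RtoC_pow; reflexivity. Qed.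

Lemma Cconj_polar (v t : R) :
  Cconj (RtoC v * expi t) = (RtoC v * expi (- t))%C.
Proof.
rewrite Cmult_conj, Cconj_expi; f_equal.
unfold Cconj, RtoC; simpl; rewrite Ropp_0; reflexivity.
Qed.

(** The common factor is [Cconj z ^ m] itself. Dividing the other two terms by it adds [m t] to
    their phases and [v ^ m] to the denominators of their moduli. *)
Lemma trinomial_on_circle (n m : nat) (b c : C) (hc : c <> RtoC 0)
  (v t : R) (hv : 0 < v) :
  let z := (RtoC v * expi t)%C in
  (z ^ (n + m) + b * Cconj z ^ m + c)%C =
  (RtoC (v ^ m) * expi (INR m * - t) *
   (b + (RtoC (v ^ n) * expi ((INR n + 2 * INR m) * t)
         + RtoC (Cmod c / v ^ m) * expi (Carg c + INR m * t))))%C.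
Proof.
intro z; unfold z; clear z.
pose proof (pow_lt v m hv) as Hvm.
rewrite Cconj_polar, !polar_pow, plus_INR.
(* Only the constant term is put in polar form; its phase, its modulus and the phase of the leading
   term are then split to expose the common factor. *)
rewrite (Carg_polar c hc) at 1.
replace ((INR n + INR m) * t)
  with (INR m * - t + (INR n + 2 * INR m) * t) by ring.
replace (Carg c) with (INR m * - t + (Carg c + INR m * t)) at 1 by ring.
rewrite (expi_plus (INR m * - t)), (expi_plus (INR m * - t)), pow_add.
replace (Cmod c) with (v ^ m * (Cmod c / v ^ m)) at 1 by (field; lra).
rewrite !RtoC_mult; ring.
Qed.

(** The common factor has modulus [v ^ m > 0], so only the bracket can vanish. *)
Lemma trinomial_root_on_circle (n m : nat) (b c : C) (hc : c <> RtoC 0)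
  (v t : R) (hv : 0 < v) :
  let z := (RtoC v * expi t)%C in
  (z ^ (n + m) + b * Cconj z ^ m + c)%C = RtoC 0 <->
  (- b)%C = (RtoC (v ^ n) * expi ((INR n + 2 * INR m) * t)
             + RtoC (Cmod c / v ^ m) * expi (Carg c + INR m * t))%C.
Proof.
intro z; unfold z; clear z.
rewrite (trinomial_on_circle n m b c hc v t hv).
set (T := (_ + RtoC (Cmod c / _) * _)%C).
pose proof (pow_lt v m hv) as Hvm.
assert (Hk : (RtoC (v ^ m) * expi (INR m * - t))%C <> RtoC 0).
{ apply Cmult_neq_0; [|apply expi_neq_0].
  intro H; apply RtoC_inj in H; lra. }
split; intro H.
(* [Cmult_neq_0] excludes zero divisors in contrapositive form, hence the case split on the
   bracket. *)
- destruct (Ceq_dec (b + T)%C (RtoC 0)) as [H0|H0].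
  + replace T with (b + T - b)%C by ring; rewrite H0; ring.
  + destruct (Cmult_neq_0 _ _ Hk H0 H).
- rewrite <- H; ring.
Qed.

Theorem theorem2p1 (n m : nat) (hn : (0 < n)%nat) (hm : (0 < m)%nat)
  (hnm : Nat.gcd n m = 1%nat) (b c : C) (hc : c <> RtoC 0)
  (v : R) (hv : 0 < v) :
  let h := fun z : C => (z ^ (n + m) + b * Cconj z ^ m + c)%C in
  let R0 := v ^ n / (2 * INR m) * (INR n + 2 * INR m) in
  let r := v ^ n / (2 * INR m) * INR n in
  let d := Cmod c / v ^ m in
  let gamma := Carg c in
  (exists zeta : C, h zeta = RtoC 0 /\ Cmod zeta = v) <->
  trochoid R0 r d gamma (- b)%C.
Proof.
intros h R0 r d gamma.
pose proof (lt_0_INR n hn) as Hn; pose proof (lt_0_INR m hm) as Hm.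
pose proof (pow_lt v n hv) as Hvn.
assert (HRr : R0 - r = v ^ n) by (unfold R0, r; field; lra).
assert (Hratio : (R0 - r) / (2 * R0) = INR m / (INR n + 2 * INR m)).
{ rewrite HRr; unfold R0; field; lra. }
unfold trochoid; rewrite Hratio, HRr; split.
- intros [zeta [Hz Hmod]].
  (* As [v > 0], the root is nonzero and has a polar form with the principal argument as angle. *)
  assert (Hz0 : zeta <> RtoC 0) by (apply Cmod_gt_0; lra).
  pose proof (Carg_polar zeta Hz0) as Hp; rewrite Hmod in Hp.
  exists ((INR n + 2 * INR m) * Carg zeta).
  replace (INR m / (INR n + 2 * INR m) * ((INR n + 2 * INR m) * Carg zeta))
    with (INR m * Carg zeta) by (field; lra).
  apply (trinomial_root_on_circle n m b c hc v (Carg zeta) hv).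
  rewrite <- Hp; exact Hz.
- intros [phi Hphi].
  (* The substitution is inverted; this angle may be any real number, since the root criterion holds
     for every [t]. *)
  exists (RtoC v * expi (phi / (INR n + 2 * INR m)))%C; split.
  + apply (trinomial_root_on_circle n m b c hc v _ hv).
    replace ((INR n + 2 * INR m) * (phi / (INR n + 2 * INR m)))
      with phi by (field; lra).
    replace (INR m * (phi / (INR n + 2 * INR m)))
      with (INR m / (INR n + 2 * INR m) * phi) by (field; lra).
    exact Hphi.
  + rewrite Cmod_mult, Cmod_expi, Cmod_R, Rabs_pos_eq; lra.
Qed.
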